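(* Let $D\ge2$ and $l\ge1$. The projector $\mathcal P^{l+1}$ can be expressed as a polynomial in the permutators $\mathsf P_{12},\dots,\mathsf P_{l(l+1)}$ and the trace projectors $\mathcal P^t_{12},\dots,\mathcal P^t_{l(l+1)}$ through either recursive relation $$\mathcal P^{l+1}=\mathcal P^l_{12\dots l}\,M_{l(l+1)}\,\mathcal P^l_{12\dots l},\qquad \mathcal P^{l+1}=\mathcal P^l_{2\dots(l+1)}\,M_{12}\,\mathcal P^l_{2\dots(l+1)},$$ where $$M\equiv M(l+1)=\frac1{l+1}\Big[\mathbf 1_{D^2}+l\,\mathsf P-\frac{2Dl}{D+2l-2}\,\mathcal P^t\Big].$$ As a consequence the $\mathcal P^l$ are symmetric, $(\mathcal P^l)^T=\mathcal P^l$.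
   Context: Let $\mathcal E=\mathbb R^D$ with its standard orthonormal basis. On $\mathcal E\otimes\mathcal E$: $\mathbf 1_{D^2}$ is the identity, $\mathsf P(u\otimes v)=v\otimes u$ is the permutator, and $\mathcal P^t$ is the trace projector with components $\mathcal P^t{}^{ij}_{kl}=\frac1D\delta^{ij}\delta_{kl}$; $\mathcal P^-=\frac12(\mathbf 1_{D^2}-\mathsf P)$. For $l\ge1$, $\mathcal P^l$ is the completely symmetric trace-free projector on $\mathcal E^{\otimes l}$, i.e. the projector with image the space of completely symmetric trace-free tensors characterized by $(\mathcal P^l)^2=\mathcal P^l$ and $\mathcal P^l\mathcal P^-_{n(n+1)}=\mathcal P^l\mathcal P^t_{n(n+1)}=0=\mathcal P^-_{n(n+1)}\mathcal P^l=\mathcal P^t_{n(n+1)}\mathcal P^l$ for $n=1,\dots,l-1$; $\mathcal P^1=\mathbf 1_D$. For an operator $M$ on $\mathcal E^{\otimes n}$, $M_{h(h+1)\dots(h+n-1)}$ denotes the operator on a larger tensor power (here $\mathcal E^{\otimes(l+1)}$) acting as $M$ on the tensor factors $h,\dots,h+n-1$ and as the identity on the others. $^T$ is matrix transposition in the orthonormal basis. *)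

(* Defs.v *)
From mathcomp Require Import all_boot all_order all_fingroup all_algebra.
From mathcomp Require Import boolp reals zify.

Set Implicit Arguments.
Unset Strict Implicit.
Unset Printing Implicit Defensive.

Import Order.TTheory GRing.Theory Num.Theory.
Local Open Scope ring_scope.

(* Multi-indices labelling the standard orthonormal basis of the n-th tensor
   power of R^D.  Tensors are columns, and operators square matrices, in this
   basis; rows carry the upper indices and columns the lower ones.  Products,
   identity and transpose are then those of matrices. *)
Notation idx D n := {ffun 'I_n -> 'I_D}.
Notation tensor R D n := 'cV[R]_#|{: idx D n}|.
Notation op R D n := 'M[R]_#|{: idx D n}|.

Definition tcoef (R : realType) (D n : nat) (t : tensor R D n) (I : idx D n) : R :=
  t (enum_rank I) 0.

Definition op_of (R : realType) (D n : nat) (F : idx D n -> idx D n -> R) :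
    op R D n :=
  \matrix_(i, j) F (enum_val i) (enum_val j).

Definition ocoef (R : realType) (D n : nat) (M : op R D n) (I J : idx D n) : R :=
  M (enum_rank I) (enum_rank J).

Definition permutator (R : realType) (D : nat) : op R D 2 :=
  op_of (fun I J => ((I 0 == J 1) && (I 1 == J 0))%:R).

Definition trace_proj (R : realType) (D : nat) : op R D 2 :=
  op_of (fun I J => D%:R^-1 * (I 0 == I 1)%:R * (J 0 == J 1)%:R).

Definition antisym_proj (R : realType) (D : nat) : op R D 2 :=
  2^-1 *: (1%:M - permutator R D).

(* The window of n consecutive factors starting after the first h ones: its
   a-th element is the factor h + a, all positions being counted from 0. *)
Definition window (h n N : nat) (hn : (h + n <= N)%N) (a : 'I_n) : 'I_N :=
  widen_ord hn (rshift h a).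

(* M_{(h+1)...(h+n)}, in the 1-based numbering of the factors. *)
Definition legs (R : realType) (D h n N : nat) (hn : (h + n <= N)%N)
    (M : op R D n) : op R D N :=
  op_of (fun I J =>
    ocoef M [ffun a => I (window hn a)] [ffun a => J (window hn a)] *
    [forall k : 'I_N, (h <= k < h + n)%N || (I k == J k)]%:R).

Definition symmetric_tensor (R : realType) (D n : nat) (t : tensor R D n) : Prop :=
  forall (s : 'S_n) (I : idx D n), tcoef t [ffun k => I (s k)] = tcoef t I.

Definition set2_idx (D n : nat) (p q : 'I_n) (a : 'I_D) (I : idx D n) : idx D n :=
  [ffun k => if (k == p) || (k == q) then a else I k].

Definition trace_free (R : realType) (D n : nat) (t : tensor R D n) : Prop :=
  forall (p q : 'I_n) (I : idx D n), p != q ->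
    \sum_(a < D) tcoef t (set2_idx p q a I) = 0.

Definition is_stf_proj (R : realType) (D n : nat) (P : op R D n) : Prop :=
  [/\ P *m P = P,
      forall t : tensor R D n,
        (exists u : tensor R D n, t = P *m u) <->
        (symmetric_tensor t /\ trace_free t)
    & forall (h : nat) (hh : (h + 2 <= n)%N),
        [/\ P *m legs hh (antisym_proj R D) = 0,
            P *m legs hh (trace_proj R D) = 0,
            legs hh (antisym_proj R D) *m P = 0
          & legs hh (trace_proj R D) *m P = 0]].

Lemma ocoef_op_of (R : realType) (D n : nat) (F : idx D n -> idx D n -> R) I J :
  ocoef (op_of F) I J = F I J.
Proof. by rewrite /ocoef mxE !enum_rankK. Qed.

Lemma tcoef_mul (R : realType) (D n : nat) (M : op R D n) (t : tensor R D n) I :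
  tcoef (M *m t) I = \sum_J ocoef M I J * tcoef t J.
Proof.
rewrite /tcoef mxE (reindex enum_rank) //=; exact/onW_bij/enum_rank_bij.
Qed.

Lemma tensorP (R : realType) (D n : nat) (t u : tensor R D n) :
  (forall I, tcoef t I = tcoef u I) -> t = u.
Proof.
move=> tu; apply/matrixP => i j; rewrite (ord1 j) -(enum_valK i); exact: tu.
Qed.

Definition pure2 (R : realType) (D : nat) (u v : 'cV[R]_D) : tensor R D 2 :=
  \col_i (let I : idx D 2 := enum_val i in u (I 0) 0 * v (I 1) 0).

Definition swap_idx (D n : nat) (p q : 'I_n) (I : idx D n) : idx D n :=
  [ffun k => I (tperm p q k)].

Lemma permutator_mul (R : realType) (D : nat) (t : tensor R D 2) I :
  tcoef (permutator R D *m t) I = tcoef t (swap_idx 0 1 I).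
Proof.
rewrite tcoef_mul (bigD1 (swap_idx 0 1 I)) //= big1 ?addr0.
  by rewrite ocoef_op_of !ffunE tpermR tpermL !eqxx mul1r.
move=> J neJ; rewrite ocoef_op_of.
case: andP => [[/eqP e0 /eqP e1]|]; last by rewrite mul0r.
case/eqP: neJ; apply/ffunP => k; rewrite ffunE.
have [-> | ->] : k = 0 \/ k = 1.
  by case: k => [[|[|//]] hk]; [left|right]; apply/val_inj.
  by rewrite tpermL e1.
by rewrite tpermR e0.
Qed.

Lemma permutator_pure (R : realType) (D : nat) (u v : 'cV[R]_D) :
  permutator R D *m pure2 u v = pure2 v u.
Proof.
apply: tensorP => I; rewrite permutator_mul /tcoef !mxE /= !enum_rankK !ffunE.
by rewrite tpermL tpermR mulrC.
Qed.

Lemma subspace_mx (F : fieldType) (N : nat) (S : 'rV[F]_N -> Prop) :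
  S 0 -> (forall a u v, S u -> S v -> S (a *: u + v)) ->
  exists B : 'M[F]_N, forall v, S v <-> (v <= B)%MS.
Proof.
move=> S0 SD.
pose Q k := `[< exists B : 'M[F]_N,
  (forall v : 'rV_N, (v <= B)%MS -> S v) /\ \rank B = k >].
have exQ : exists k, Q k.
  exists 0; apply/asboolP; exists 0; split; last by rewrite mxrank0.
  by move=> v; rewrite submx0 => /eqP ->.
have ubQ k : Q k -> (k <= N)%N.
  by move=> /asboolP[B [_ <-]]; exact: rank_leq_row.
case: (ex_maxnP exQ ubQ) => k /asboolP[B [SB rB]] kmax.
exists B => v; split=> [Sv|]; last exact: SB.
have /kmax : Q (\rank (B + v)%MS).
  apply/asboolP; exists (B + v)%MS; split=> // w /sub_addsmxP[[x y] /= ->].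
  rewrite addrC [y]mx11_scalar mul_scalar_mx; apply: SD => //.
  by apply: SB; exact: submxMl.
rewrite -rB => le_r.
have := mxrank_leqif_sup (addsmxSl B v) => /geq_leqif.
by rewrite le_r => /esym /(submx_trans (addsmxSr B v)).
Qed.

Lemma mul_tr_eq0 (R : realType) (N : nat) (v : 'rV[R]_N) :
  v *m v^T = 0 -> v = 0.
Proof.
move=> /matrixP/(_ 0 0); rewrite !mxE => /eqP.
rewrite psumr_eq0; last by move=> i _; rewrite mxE -expr2 sqr_ge0.
move=> /allP v0.
apply/rowP => i; have := v0 i (mem_index_enum i).
by rewrite !mxE -expr2 sqrf_eq0 => /eqP.
Qed.

Lemma orth_proj (R : realType) (N : nat) (S : 'cV[R]_N -> Prop) :
  S 0 -> (forall a u v, S u -> S v -> S (a *: u + v)) ->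
  exists P : 'M[R]_N,
    [/\ P^T = P, P *m P = P & forall t, (exists u, t = P *m u) <-> S t].
Proof.
move=> S0 SD; have [||B SB] := @subspace_mx R N (fun v => S v^T).
- by rewrite trmx0.
- by move=> a u v Su Sv; rewrite linearD linearZ; exact: SD.
have [C injC SC] : exists2 C : 'M[R]_(\rank B, N),
    row_free C & forall v, S v^T <-> (v <= C)%MS.
  by exists (row_base B) => [|v]; rewrite ?row_base_free ?eq_row_base.
pose G := C *m C^T.
have GT : G^T = G by rewrite trmx_mul trmxK.
have uG : G \in unitmx.
  rewrite -row_free_unit -kermx_eq0; apply/rowV0P => x /sub_kermxP xG.
  apply: (row_free_inj injC); rewrite mul0mx.
  by apply: mul_tr_eq0; rewrite trmx_mul mulmxA -(mulmxA x) xG mul0mx.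
pose P := C^T *m invmx G *m C.
have PT : P^T = P by rewrite !trmx_mul trmxK trmx_inv GT mulmxA.
exists P; split=> // [|t].
  by rewrite /P !mulmxA -(mulmxA _ C C^T) mulmxKV.
rewrite -[t in S t]trmxK SC.
split=> [[u ->]|/submxP[x tE]].
  by rewrite trmx_mul PT /P mulmxA submxMl.
exists t; rewrite -[t]trmxK tE trmx_mul /P !mulmxA -(mulmxA _ C C^T) -/G.
by rewrite mulmxKV.
Qed.

Lemma symmetric_tensor_lin (R : realType) (D n : nat) (a : R)
    (t u : tensor R D n) :
  symmetric_tensor t -> symmetric_tensor u -> symmetric_tensor (a *: t + u).
Proof.
move=> st su s I; have := st s I; have := su s I.
by rewrite /tcoef !mxE => -> ->.
Qed.

Lemma trace_free_lin (R : realType) (D n : nat) (a : R)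
    (t u : tensor R D n) :
  trace_free t -> trace_free u -> trace_free (a *: t + u).
Proof.
move=> tt tu p q I pq; have := tt p q I pq; have := tu p q I pq.
rewrite /tcoef => u0 t0; under eq_bigr do rewrite !mxE.
by rewrite big_split -mulr_sumr /= u0 t0 mulr0 addr0.
Qed.

Lemma window2P (h n : nat) (hh : (h + 2 <= n)%N) (k : 'I_n) :
  (h <= k < h + 2)%N = (k == window hh 0) || (k == window hh 1).
Proof. by rewrite -!val_eqE /=; lia. Qed.

Lemma window2_neq (h n : nat) (hh : (h + 2 <= n)%N) :
  window hh 0 != window hh 1.
Proof. by rewrite -val_eqE /=; lia. Qed.

Lemma legsB (R : realType) (D h n N : nat) (hn : (h + n <= N)%N)
    (A B : op R D n) : legs hn (A - B) = legs hn A - legs hn B.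
Proof. by apply/matrixP => i j; rewrite !mxE /ocoef !mxE mulrBl. Qed.

Lemma legsZ (R : realType) (D h n N : nat) (hn : (h + n <= N)%N)
    (a : R) (A : op R D n) : legs hn (a *: A) = a *: legs hn A.
Proof. by apply/matrixP => i j; rewrite !mxE /ocoef !mxE mulrA. Qed.

Lemma legs1 (R : realType) (D h n N : nat) (hn : (h + n <= N)%N) :
  legs hn (1%:M : op R D n) = 1%:M.
Proof.
apply/matrixP => i j; rewrite !mxE /ocoef !mxE (inj_eq enum_rank_inj) -natrM mulnb.
congr (_%:R); congr nat_of_bool; rewrite -(inj_eq enum_val_inj).
apply/andP/eqP => [[/eqP/ffunP win /forallP out]|->]; last first.
  by split; [|apply/forallP => k; rewrite eqxx orbT].
apply/ffunP => k; have /orP[/andP[hk kh]|/eqP//] := out k.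
have lt_kn : (k - h < n)%N by lia.
have -> : k = window hn (Ordinal lt_kn) by apply/val_inj => /=; lia.
by have := win (Ordinal lt_kn); rewrite !ffunE.
Qed.

Lemma tcoef_legs_perm (R : realType) (D h n : nat) (hh : (h + 2 <= n)%N)
    (t : tensor R D n) I :
  tcoef (legs hh (permutator R D) *m t) I =
  tcoef t (swap_idx (window hh 0) (window hh 1) I).
Proof.
set k0 := window hh 0; set k1 := window hh 1.
rewrite tcoef_mul (bigD1 (swap_idx k0 k1 I)) //= big1 ?addr0.
  rewrite !ocoef_op_of !ffunE tpermR tpermL !eqxx mul1r.
  case: forallP => [_|[]k]; first by rewrite mul1r.
  rewrite (window2P hh) -/k0 -/k1 ffunE; case: tpermP => [->|->|_ _];
    by rewrite eqxx ?orbT.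
move=> J neJ; rewrite !ocoef_op_of !ffunE -/k0 -/k1.
case: andP => [[/eqP e0 /eqP e1]|]; last by rewrite !mul0r.
case: forallP => [out|]; last by rewrite mulr0 mul0r.
case/eqP: neJ; apply/ffunP => k; rewrite ffunE.
case: tpermP => [->|->|/eqP k0k /eqP k1k]; rewrite ?e0 ?e1 //.
by have := out k; rewrite (window2P hh) (negPf k0k) (negPf k1k) => /eqP.
Qed.

Lemma tcoef_legs_trace (R : realType) (D h n : nat) (hh : (h + 2 <= n)%N)
    (t : tensor R D n) I :
  tcoef (legs hh (trace_proj R D) *m t) I =
  D%:R^-1 * (I (window hh 0) == I (window hh 1))%:R *
  \sum_(a < D) tcoef t (set2_idx (window hh 0) (window hh 1) a I).
Proof.
set k0 := window hh 0; set k1 := window hh 1.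
rewrite tcoef_mul; pose out (J : idx D n) :=
  [forall k : 'I_n, (h <= k < h + 2)%N || (I k == J k)].
transitivity (\sum_(J : idx D n | (J k0 == J k1) && out J)
    D%:R^-1 * (I k0 == I k1)%:R * tcoef t J).
  rewrite [RHS]big_mkcond; apply: eq_bigr => J _.
  rewrite !ocoef_op_of !ffunE -/k0 -/k1 -/(out J).
  by case: (J k0 == J k1); case: (out J);
    rewrite /= ?mulr1n ?mulr0n ?(mulr0, mulr1, mul0r).
rewrite -mulr_sumr; congr (_ * _).
rewrite (reindex_onto (fun a => set2_idx k0 k1 a I)
  (fun J : idx D n => J k0)) /=.
  apply: eq_bigl => a; rewrite !ffunE !eqxx orbT eqxx /= andbT.
  by apply/forallP => k; rewrite (window2P hh) ffunE -/k0 -/k1;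
    case: ((k == k0) || (k == k1)) => /=.
move=> J /andP[/eqP J01 /forallP oJ]; apply/ffunP => k; rewrite ffunE.
have := oJ k; rewrite (window2P hh) -/k0 -/k1.
by case: eqP => [->//|_]; case: eqP => [->//|_] /= /eqP.
Qed.

Lemma legs_antisym_eq0 (R : realType) (D h n : nat) (hh : (h + 2 <= n)%N)
    (t : tensor R D n) :
  legs hh (antisym_proj R D) *m t = 0 <->
  forall I, tcoef t (swap_idx (window hh 0) (window hh 1) I) = tcoef t I.
Proof.
rewrite legsZ legsB legs1 -scalemxAl mulmxBl mul1mx; split=> [t0 I|ts].
  move/eqP: t0; rewrite scaler_eq0 invr_eq0 pnatr_eq0 /= subr_eq0 => /eqP tE.
  by rewrite -tcoef_legs_perm -tE.
rewrite (_ : t - _ = 0) ?scaler0 //; apply/eqP; rewrite subr_eq0; apply/eqP.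
by apply: tensorP => I; rewrite tcoef_legs_perm ts.
Qed.

Lemma sym_legs_antisym (R : realType) (D h n : nat) (hh : (h + 2 <= n)%N)
    (t : tensor R D n) :
  symmetric_tensor t -> legs hh (antisym_proj R D) *m t = 0.
Proof. by move=> st; apply/legs_antisym_eq0 => I; exact: st. Qed.

Lemma tf_legs_trace (R : realType) (D h n : nat) (hh : (h + 2 <= n)%N)
    (t : tensor R D n) :
  trace_free t -> legs hh (trace_proj R D) *m t = 0.
Proof.
move=> tt; apply: tensorP => I; rewrite tcoef_legs_trace.
by rewrite tt ?window2_neq // mulr0 /tcoef mxE.
Qed.

Lemma antisym_proj_tr (R : realType) (D : nat) :
  (antisym_proj R D)^T = antisym_proj R D.
Proof.
apply/matrixP => i j; rewrite !mxE eq_sym; congr (_ * (_ - (nat_of_bool _)%:R)).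
by rewrite andbC; congr (_ && _); exact: eq_sym.
Qed.

Lemma trace_proj_tr (R : realType) (D : nat) :
  (trace_proj R D)^T = trace_proj R D.
Proof. by apply/matrixP => i j; rewrite !mxE mulrAC. Qed.

Lemma legs_tr (R : realType) (D h n N : nat) (hn : (h + n <= N)%N)
    (M : op R D n) : (legs hn M)^T = legs hn M^T.
Proof.
apply/matrixP => i j; rewrite !mxE /ocoef !mxE; congr (_ * (nat_of_bool _)%:R).
by apply: eq_forallb => k; rewrite eq_sym.
Qed.

Lemma mulmx_eq0_col (R : realType) (N : nat) (A P : 'M[R]_N) :
  (forall u : 'cV_N, A *m (P *m u) = 0) -> A *m P = 0.
Proof.
move=> AP; apply/matrixP => i j.
have /matrixP/(_ i 0) := AP (delta_mx j 0).
by rewrite mulmxA -colE !mxE => ->.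
Qed.

Lemma stf_proj_exists_tr (R : realType) (D n : nat) :
  exists P : op R D n, P^T = P /\ is_stf_proj P.
Proof.
have [||P [PT PP imP]] := @orth_proj R _
    (fun t : tensor R D n => symmetric_tensor t /\ trace_free t).
- split=> [s I|p q I _]; first by rewrite /tcoef !mxE.
  by apply: big1 => a _; rewrite /tcoef mxE.
- move=> a u v [su tu] [sv tv].
  by split; [exact: symmetric_tensor_lin|exact: trace_free_lin].
exists P; split=> //; split=> // h hh.
have aP : legs hh (antisym_proj R D) *m P = 0.
  apply: mulmx_eq0_col => u; apply: sym_legs_antisym.
  by case: (imP (P *m u)) => + _; case; first by exists u.
have tP : legs hh (trace_proj R D) *m P = 0.
  apply: mulmx_eq0_col => u; apply: tf_legs_trace.
  by case: (imP (P *m u)) => + _; case; first by exists u.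
split=> //; apply: trmx_inj.
  by rewrite trmx_mul PT legs_tr antisym_proj_tr aP trmx0.
by rewrite trmx_mul PT legs_tr trace_proj_tr tP trmx0.
Qed.

Lemma legs_ker (R : realType) (D n : nat) (t : tensor R D n) :
  (forall (h : nat) (hh : (h + 2 <= n)%N),
     legs hh (antisym_proj R D) *m t = 0 /\ legs hh (trace_proj R D) *m t = 0) ->
  symmetric_tensor t /\ trace_free t.
Proof.
move=> kt; pose fix_t (s : 'S_n) :=
  forall I : idx D n, tcoef t [ffun k => I (s k)] = tcoef t I.
have fixM s s' : fix_t s -> fix_t s' -> fix_t (s * s')%g.
  move=> fs fs' I; rewrite -(fs' I) -(fs [ffun k => I (s' k)]); congr tcoef.
  by apply/ffunP => k; rewrite !ffunE permM.
have fix1 : fix_t 1%g.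
  by move=> I; congr tcoef; apply/ffunP => k; rewrite ffunE perm1.
have fixadj (p q : 'I_n) : p.+1 = q -> fix_t (tperm p q).
  move=> pq; have hh : (p + 2 <= n)%N by have := ltn_ord q; lia.
  have [/legs_antisym_eq0 ft _] := kt _ hh.
  have -> : p = window hh 0 by apply/val_inj => /=; lia.
  have -> : q = window hh 1 by apply/val_inj => /=; lia.
  by move=> I; exact: ft.
have fixlt m (p q : 'I_n) : (p + m).+1 = q -> fix_t (tperm p q).
  elim: m q => [|m IHm] q pq; first by apply: fixadj; lia.
  have lt_r : ((p + m).+1 < n)%N by have := ltn_ord q; lia.
  pose r := Ordinal lt_r.
  have fpr : fix_t (tperm p r) by exact: IHm.
  have frq : fix_t (tperm r q) by apply: fixadj => /=; lia.
  have -> : tperm p q = (tperm r q * (tperm p r * tperm r q))%g.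
    have := tpermJ p r (tperm r q); rewrite /conjg tpermV tpermL => ->.
    by congr tperm; rewrite tpermD // -val_eqE /=; lia.
  by apply: (fixM _ _ frq); apply: fixM.
have fixt p q : fix_t (tperm p q).
  case: (ltngtP p q) => [lt_pq|lt_qp|/val_inj ->]; last by rewrite tperm1.
    by apply: (fixlt (q - p.+1)%N); lia.
  by rewrite tpermC; apply: (fixlt (p - q.+1)%N); lia.
have st : symmetric_tensor t.
  move=> s; have [ts -> _] := prod_tpermP s.
  by elim: ts => [|a ts IHts]; rewrite ?big_nil ?big_cons //; exact: fixM.
split=> // p q I pq.
have n2 : (0 + 2 <= n)%N.
  by have := ltn_ord p; have := ltn_ord q; move: pq; rewrite -val_eqE /=; lia.
pose k0 := window n2 0; pose k1 := window n2 1.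
have [s s0 s1] : exists2 s : 'S_n, s k0 = p & s k1 = q.
  pose q' := tperm p k0 q.
  have q'k0 : q' != k0.
    by rewrite -[X in _ != X](tpermL p k0) (inj_eq perm_inj) eq_sym.
  have k1k0 : k1 != k0 by rewrite eq_sym window2_neq.
  exists (tperm k1 q' * tperm p k0)%g; rewrite permM; first by rewrite (tpermD k1k0 q'k0) tpermR.
  by rewrite tpermL /q' tpermK.
have [a0|] := boolP (D == 0)%N.
  by rewrite big1 // => a; have := ltn_ord a; rewrite {2}(eqP a0).
move=> D0; have D_gt0 : (0 < D)%N by rewrite lt0n.
have [_ /(congr1 (fun u => tcoef u
    [ffun k => set2_idx p q (Ordinal D_gt0) I (s k)]))] := kt _ n2.
rewrite tcoef_legs_trace -/k0 -/k1 !ffunE s0 s1 !eqxx orbT eqxx mulr1.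
rewrite {2}/tcoef mxE => /eqP; rewrite mulf_eq0 invr_eq0 pnatr_eq0 (negPf D0).
move=> /eqP sum0; rewrite -[RHS]sum0; apply: eq_bigr => a _.
rewrite -(st s); congr tcoef; apply/ffunP => k; rewrite !ffunE.
rewrite -s0 -s1 !(inj_eq (@perm_inj _ s)).
by case: ifP.
Qed.

Lemma stf_proj_unique (R : realType) (D n : nat) (P Q : op R D n) :
  is_stf_proj P -> is_stf_proj Q -> P = Q.
Proof.
have [P0 [P0T [PP0 imP0 _]]] := stf_proj_exists_tr R D n.
suff H A : is_stf_proj A -> A = P0 by move=> /H -> /H ->.
move=> [AA imA kA].
have fixA t : symmetric_tensor t /\ trace_free t -> A *m t = t.
  by move=> /imA[u ->]; rewrite mulmxA AA.
have fixP0 t : symmetric_tensor t /\ trace_free t -> P0 *m t = t.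
  by move=> /imP0[u ->]; rewrite mulmxA PP0.
have AP0 : A *m P0 = P0.
  apply/eqP; rewrite -subr_eq0 -{2}[P0]mul1mx -mulmxBl; apply/eqP.
  apply: mulmx_eq0_col => u; rewrite mulmxBl mul1mx fixA ?subrr //.
  by apply/imP0; exists u.
have P0AT : P0 *m A^T = A^T.
  apply/eqP; rewrite -subr_eq0 -{2}[A^T]mul1mx -mulmxBl; apply/eqP.
  apply: mulmx_eq0_col => u; rewrite mulmxBl mul1mx fixP0 ?subrr //.
  apply: legs_ker => h hh; have [aA tA _ _] := kA h hh.
  rewrite !mulmxA -{1}antisym_proj_tr -{1}trace_proj_tr -!legs_tr -!trmx_mul.
  by rewrite aA tA !trmx0 !mul0mx.
by rewrite -AP0 -[A in LHS]trmxK -P0AT trmx_mul trmxK P0T.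
Qed.

Lemma stf_proj_exists (R : realType) (D n : nat) :
  exists P : op R D n, is_stf_proj P.
Proof. by have [P []] := stf_proj_exists_tr R D n; exists P. Qed.

(* P^n, obtained from its characterization; cf. stf_proj_unique. *)
Definition stf_proj (R : realType) (D n : nat) : op R D n :=
  sval (cid (stf_proj_exists R D n)).

Lemma stf_projP (R : realType) (D n : nat) : is_stf_proj (stf_proj R D n).
Proof. by rewrite /stf_proj; case: cid. Qed.

Lemma stf_projE (R : realType) (D n : nat) (P : op R D n) :
  is_stf_proj P <-> P = stf_proj R D n.
Proof.
split=> [sP|->]; last exact: stf_projP.
exact: stf_proj_unique sP (stf_projP R D n).
Qed.

Lemma stf_proj1 (R : realType) (D : nat) : stf_proj R D 1 = 1%:M.
Proof.
apply/esym/stf_projE; split=> [|t|h hh]; [exact: mulmx1| |lia].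
split=> [_|_]; last by exists t; rewrite mul1mx.
split=> [s I|p q I]; last by rewrite !ord1 eqxx.
by congr tcoef; apply/ffunP => k; rewrite ffunE !ord1.
Qed.

(* The matrices that are polynomials, with real coefficients, in (noncommuting)
   matrices satisfying gen. *)
Inductive is_polynomial_in (R : realType) (N : nat) (gen : 'M[R]_N -> Prop) :
    'M[R]_N -> Prop :=
| poly_gen A of gen A : is_polynomial_in gen A
| poly_scalar (c : R) : is_polynomial_in gen c%:M
| poly_add A B of is_polynomial_in gen A & is_polynomial_in gen B :
    is_polynomial_in gen (A + B)
| poly_mul A B of is_polynomial_in gen A & is_polynomial_in gen B :
    is_polynomial_in gen (A *m B).

Definition perm_or_trace (R : realType) (D n : nat) (A : op R D n) : Prop :=
  exists (h : nat) (hh : (h + 2 <= n)%N),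
    A = legs hh (permutator R D) \/ A = legs hh (trace_proj R D).

(* M(l+1) *)
Definition recM (R : realType) (D l : nat) : op R D 2 :=
  (l%:R + 1)^-1 *:
    (1%:M + l%:R *: permutator R D
     - (2 * D%:R * l%:R / (D%:R + 2 * l%:R - 2)) *: trace_proj R D).

Lemma first_factors (l : nat) : (0 + l <= l.+1)%N.
Proof. exact: leqnSn. Qed.

Lemma last_factors (l : nat) : (1 + l <= l.+1)%N.
Proof. exact: leqnn. Qed.

Lemma first_pair (l : nat) (hl : (1 <= l)%N) : (0 + 2 <= l.+1)%N.
Proof. exact: hl. Qed.

Lemma last_pair (l : nat) (hl : (1 <= l)%N) : (l.-1 + 2 <= l.+1)%N.
Proof. by rewrite addn2 prednK. Qed.

(* Main.v *)
Require Import Defs.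
From mathcomp Require Import all_boot all_order all_fingroup all_algebra.
From mathcomp Require Import boolp reals zify ring.

(* Let z be the last (first) factor, y its neighbour, and w a tensor that is
   symmetric and trace-free in the factors other than z. With
   G(I) = [I_y = I_z] (tr_yz w)(I), the average T over all permutations of the
   l+1 factors of w - l / (D + 2l - 2) G is symmetric, and the coefficient is
   the one that makes it trace-free. On the other hand T has the same scalar
   products as M_yz w with the tensors symmetric and trace-free off z, so the
   orthogonal projection A = P^l onto these sends M_yz w to T. Hence A M A maps
   into the symmetric trace-free tensors; it fixes them and is a symmetric
   matrix, so it is P^(l+1). *)

Set Implicit Arguments.
Unset Strict Implicit.
Unset Printing Implicit Defensive.

Import Order.TTheory GRing.Theory Num.Theory.
Local Open Scope ring_scope.

(** * Permutations of multi-indices and contraction of a pair of factors *)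

Definition perm_idx (D n : nat) (s : 'S_n) (I : idx D n) : idx D n :=
  [ffun k => I (s k)].

(** These are the coefficient functions of the tensors in the image of the projector $\mathcal P^l$
    placed on the factors other than [z]. *)
Definition stf_away (R : realType) (D n : nat) (z : 'I_n) (f : idx D n -> R) : Prop :=
  (forall (s : 'S_n) I, s z = z -> f (perm_idx s I) = f I) /\
  (forall p q I, p != q -> p != z -> q != z ->
     \sum_(a < D) f (set2_idx p q a I) = 0).

Definition pair_trace (R : realType) (D n : nat) (y z : 'I_n)
    (f : idx D n -> R) (I : idx D n) : R :=
  \sum_(a < D) f (set2_idx y z a I).

(** This is $D$ times the trace projector on the factors [y] and [z]. *)
Definition contr (R : realType) (D n : nat) (y z : 'I_n)
    (f : idx D n -> R) (I : idx D n) : R :=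
  (I y == I z)%:R * pair_trace y z f I.

Lemma perm_idxM (D n : nat) (s t : 'S_n) (I : idx D n) :
  perm_idx s (perm_idx t I) = perm_idx (s * t)%g I.
Proof. by apply/ffunP => k; rewrite !ffunE permM. Qed.

Lemma perm_idx_bij (D n : nat) (s : 'S_n) : bijective (@perm_idx D n s).
Proof.
by exists (perm_idx s^-1%g) => I; rewrite perm_idxM ?mulVg ?mulgV;
  apply/ffunP => k; rewrite ffunE perm1.
Qed.

Lemma perm_idx_set2 (D n : nat) (s : 'S_n) (p q : 'I_n) (a : 'I_D) (I : idx D n) :
  perm_idx s (set2_idx p q a I) =
  set2_idx (s^-1%g p) (s^-1%g q) a (perm_idx s I).
Proof.
by apply/ffunP => k; rewrite !ffunE !(canF_eq (permK s)).
Qed.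

Lemma perm_idx_tperm_id (D n : nat) (p q : 'I_n) (I : idx D n) :
  I p = I q -> perm_idx (tperm p q) I = I.
Proof. by move=> Ipq; apply/ffunP => k; rewrite ffunE; case: tpermP => [->|->|]. Qed.

Lemma set2_idxl (D n : nat) (p q : 'I_n) (a : 'I_D) (I : idx D n) :
  set2_idx p q a I p = a.
Proof. by rewrite ffunE eqxx. Qed.

Lemma set2_idxr (D n : nat) (p q : 'I_n) (a : 'I_D) (I : idx D n) :
  set2_idx p q a I q = a.
Proof. by rewrite ffunE eqxx orbT. Qed.

Lemma set2_idxK (D n : nat) (p q : 'I_n) (a b : 'I_D) (I : idx D n) :
  set2_idx p q a (set2_idx p q b I) = set2_idx p q a I.
Proof. by apply/ffunP => k; rewrite !ffunE; case: (_ || _). Qed.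

Lemma set2_idxC (D n : nat) (p q : 'I_n) (a : 'I_D) (I : idx D n) :
  set2_idx p q a I = set2_idx q p a I.
Proof. by apply/ffunP => k; rewrite !ffunE orbC. Qed.

Lemma set2_idx_id (D n : nat) (p q : 'I_n) (a : 'I_D) (I : idx D n) :
  I p = a -> I q = a -> set2_idx p q a I = I.
Proof.
move=> Ip Iq; apply/ffunP => k; rewrite ffunE.
by case: eqP => [->|_] //=; case: eqP => [->|].
Qed.

(** * Traces over [y] and [z] of permuted tensors *)

(** A multi-index with equal entries at [y] and [z] is unchanged by their swap, so a permutation
    sending [z] to [y] can be replaced by one that fixes [z]. *)
Lemma stf_away_diag (R : realType) (D n : nat) (y z : 'I_n) (f : idx D n -> R)
    (s : 'S_n) (J : idx D n) :
  stf_away z f -> J y = J z -> (s z == y) || (s z == z) ->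
  f (perm_idx s J) = f J.
Proof.
move=> [fs _] Jyz /orP[] /eqP sz; last exact: fs.
by rewrite -{1}(perm_idx_tperm_id Jyz) perm_idxM fs // permM sz tpermL.
Qed.

Lemma pair_trace_set2 (R : realType) (D n : nat) (y z : 'I_n)
    (f : idx D n -> R) (a : 'I_D) (I : idx D n) :
  pair_trace y z f (set2_idx y z a I) = pair_trace y z f I.
Proof. by apply: eq_bigr => b _; rewrite set2_idxK. Qed.

Lemma pair_trace_perm (R : realType) (D n : nat) (y z : 'I_n)
    (f : idx D n -> R) (s : 'S_n) (I : idx D n) :
  stf_away z f -> y != z -> (s y == y) || (s y == z) -> (s z == y) || (s z == z) ->
  pair_trace y z f (perm_idx s I) = pair_trace y z f I.
Proof.
move=> af yz sy sz; apply: eq_bigr => b _.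
rewrite -[RHS](stf_away_diag af _ sz) ?set2_idxl ?set2_idxr //; congr f.
rewrite perm_idx_set2.
have: s y != s z by rewrite (inj_eq perm_inj).
case/orP: sy => /eqP sy; case/orP: sz => /eqP sz; rewrite sy sz ?eqxx // => _.
  by rewrite -[in s^-1%g y]sy -[in s^-1%g z]sz !permK.
by rewrite -[in s^-1%g y]sz -[in s^-1%g z]sy !permK set2_idxC.
Qed.

Lemma contr_swap (R : realType) (D n : nat) (y z : 'I_n)
    (f : idx D n -> R) (I : idx D n) :
  stf_away z f -> y != z -> contr y z f (perm_idx (tperm y z) I) = contr y z f I.
Proof.
move=> af yz; rewrite /contr pair_trace_perm ?tpermL ?tpermR ?eqxx ?orbT //.
by rewrite !ffunE tpermL tpermR eq_sym.
Qed.

Lemma contr_perm (R : realType) (D n : nat) (y z : 'I_n)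
    (f : idx D n -> R) (s : 'S_n) (I : idx D n) :
  stf_away z f -> y != z -> (s y == y) || (s y == z) -> (s z == y) || (s z == z) ->
  contr y z f (perm_idx s I) = contr y z f I.
Proof.
move=> af yz sy sz; rewrite /contr pair_trace_perm // !ffunE.
have: s y != s z by rewrite (inj_eq perm_inj).
case/orP: sy => /eqP sy; case/orP: sz => /eqP sz; rewrite sy sz ?eqxx // => _.
by rewrite eq_sym.
Qed.

(** If [s z] is neither [y] nor [z], the sum is a trace of [f] over the factors [s^-1 y] and
    [s^-1 z], both different from [z], hence zero. Otherwise [stf_away_diag] removes [s]. *)
Lemma pair_trace_sym (R : realType) (D n : nat) (y z : 'I_n)
    (f : idx D n -> R) (s : 'S_n) (I : idx D n) :
  stf_away z f -> y != z ->
  \sum_(a < D) f (perm_idx s (set2_idx y z a I)) =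
  ((s z == y) || (s z == z))%:R * pair_trace y z f I.
Proof.
move=> af yz; case: (boolP ((s z == y) || (s z == z))) => [sz|].
  rewrite mul1r; apply: eq_bigr => a _.
  by rewrite (stf_away_diag af _ sz) ?set2_idxl ?set2_idxr.
rewrite negb_or mul0r => /andP[szy szz].
under eq_bigr do rewrite perm_idx_set2.
apply: af.2; first by rewrite (inj_eq perm_inj).
  by rewrite (can2_eq (permKV s) (permK s)) eq_sym.
by rewrite (can2_eq (permKV s) (permK s)) eq_sym.
Qed.

(** The coefficient encodes three cases: [D] if [s] preserves the pair of [y] and [z] (free sum over
    [a]), 1 if exactly one of [s y], [s z] lies in it (the delta fixes [a]), 0 if neither does. *)
Lemma pair_trace_contr (R : realType) (D n : nat) (y z : 'I_n)
    (f : idx D n -> R) (s : 'S_n) (I : idx D n) :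
  stf_away z f -> y != z ->
  let e (k : 'I_n) : R := ((k == y) || (k == z))%:R in
  \sum_(a < D) contr y z f (perm_idx s (set2_idx y z a I)) =
  (D%:R * (e (s y) * e (s z)) + e (s y) + e (s z) - 2 * (e (s y) * e (s z)))
    * pair_trace y z f I.
Proof.
move=> af yz e; rewrite /e.
have syz : s y != s z by rewrite (inj_eq perm_inj).
(* Only a = I k contributes, and then the multi-index also takes the value a
   at k, so exchanging k with the free one of y, z makes s preserve {y, z}. *)
have one (x x' k : 'I_n) : ((x == y) && (x' == z)) || ((x == z) && (x' == y)) ->
    k != y -> k != z ->
    ((s y == x) && (s z == k)) || ((s z == x) && (s y == k)) ->
    \sum_(a < D) contr y z f (perm_idx s (set2_idx y z a I)) = pair_trace y z f I.
  move=> xx' ky kz sk.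
  have xE : (x == y) || (x == z) by case/orP: xx' => /andP[-> _]; rewrite ?orbT.
  have x'E : (x' == y) || (x' == z) by case/orP: xx' => /andP[_ ->]; rewrite ?orbT.
  have xNx' : x != x'.
    by case/orP: xx' => /andP[/eqP-> /eqP->] //; rewrite eq_sym.
  have xk : x != k by case/orP: xE => /eqP ->; rewrite eq_sym.
  have val a : set2_idx y z a I x = a /\ set2_idx y z a I x' = a.
    by rewrite !ffunE xE x'E.
  have valk a : set2_idx y z a I k = I k.
    by rewrite ffunE (negPf ky) (negPf kz).
  rewrite (bigD1 (I k)) //= big1 ?addr0 => [|a aNk]; last first.
    rewrite /contr !ffunE.
    case/orP: sk => /andP[/eqP-> /eqP->];
      by rewrite (negPf ky) (negPf kz) xE ?(negPf aNk) 1?eq_sym ?(negPf aNk) mul0r.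
  set J := set2_idx y z (I k) I.
  have JE : perm_idx (tperm x' k) J = J.
    by apply: perm_idx_tperm_id; rewrite valk (val _).2.
  rewrite -[in LHS]JE perm_idxM contr_perm //; first last.
  - rewrite permM; case/orP: sk => /andP[/eqP sa /eqP sb]; rewrite ?sa ?sb ?tpermR //.
    by rewrite tpermD // eq_sym.
  - rewrite permM; case/orP: sk => /andP[/eqP sa /eqP sb]; rewrite ?sa ?sb ?tpermR //.
    by rewrite tpermD // eq_sym.
  by rewrite /contr set2_idxl set2_idxr eqxx mul1r pair_trace_set2.
case: (boolP ((s y == y) || (s y == z))) => sy;
  case: (boolP ((s z == y) || (s z == z))) => sz; rewrite ?mulr1n ?mulr0n.
- under eq_bigr do rewrite contr_perm // /contr set2_idxl set2_idxr eqxx mul1r pair_trace_set2.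
  rewrite sumr_const card_ord -mulr_natl; ring.
- rewrite (one (s y) (tperm y z (s y)) (s z)) ?eqxx //.
  - by rewrite !mulr0 subr0 add0r addr0 mul1r.
  - by case/orP: sy => /eqP ->; rewrite ?tpermL ?tpermR !eqxx ?orbT.
  - by move: sz; rewrite negb_or => /andP[].
  - by move: sz; rewrite negb_or => /andP[].
- rewrite (one (s z) (tperm y z (s z)) (s y)) ?eqxx ?orbT //.
  - by rewrite !(mul0r, mulr0) subr0 !add0r mul1r.
  - by case/orP: sz => /eqP ->; rewrite ?tpermL ?tpermR !eqxx ?orbT.
  - by move: sy; rewrite negb_or => /andP[].
  - by move: sy; rewrite negb_or => /andP[].
rewrite !mulr0 !addr0 subr0 mul0r.
move: sy sz; rewrite !negb_or => /andP[syy syz'] /andP[szy szz].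
(* The delta does not depend on [a] here. For each [b], the inner sum is a trace of [f] over
   [s^-1 y] and [s^-1 z], which differ from [y] and [z]. *)
transitivity ((I (s y) == I (s z))%:R *
   \sum_(b < D) \sum_(a < D) f (set2_idx y z b (perm_idx s (set2_idx y z a I)))).
  rewrite exchange_big mulr_sumr; apply: eq_bigr => a _ /=; rewrite /contr.
  congr ((nat_of_bool _)%:R * _); rewrite !ffunE.
  by rewrite (negPf syy) (negPf syz') (negPf szy) (negPf szz).
rewrite big1 ?mulr0 // => b _.
pose p := s^-1%g y; pose q := s^-1%g z.
have pq : p != q by rewrite (inj_eq perm_inj).
have py : p != y by rewrite (can2_eq (permKV s) (permK s)) eq_sym.
have pz : p != z by rewrite (can2_eq (permKV s) (permK s)) eq_sym.
have qy : q != y by rewrite (can2_eq (permKV s) (permK s)) eq_sym.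
have qz : q != z by rewrite (can2_eq (permKV s) (permK s)) eq_sym.
rewrite -[RHS](af.2 p q (set2_idx y z b (perm_idx s I)) pq pz qz).
apply: eq_bigr => a _; congr f; rewrite perm_idx_set2 -/p -/q.
apply/ffunP => k; rewrite !ffunE.
case: eqP => [->|_] /=; first by rewrite eq_sym (negPf py) eq_sym (negPf qy).
by case: eqP => [->|_] //=; rewrite eq_sym (negPf pz) eq_sym (negPf qz).
Qed.

(** * Sums over permutations that depend on two images *)

Lemma perm2_exists (n : nat) (y z p q : 'I_n) : y != z -> p != q ->
  exists2 u : 'S_n, u y = p & u z = q.
Proof.
move=> yz pq; pose v := tperm y p.
have pz : p != v z by rewrite -[X in X != _](tpermL y p) (inj_eq perm_inj).
exists (v * tperm (v z) q)%g; rewrite permM ?tpermL //.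
by rewrite tpermD // eq_sym.
Qed.

(** By double transitivity, every ordered pair of distinct values is [(s y, s z)] for the same
    number of permutations: right multiplication by [u] carries those fixing [y] and [z] to those
    with the prescribed images. *)
Lemma sum_perm2 (R : realType) (n : nat) (y z : 'I_n) : y != z ->
  exists2 K : R, K != 0 & forall F : 'I_n -> 'I_n -> R,
    \sum_(s : 'S_n) F (s y) (s z) =
    K * (\sum_x1 \sum_x2 F x1 x2 - \sum_x F x x).
Proof.
move=> yz; pose C (x : 'I_n * 'I_n) := #|[set s : 'S_n | (s y, s z) == x]|.
have C0 x : C (x, x) = 0%N.
  apply: eq_card0 => s; rewrite inE xpair_eqE; apply/negP => /andP[/eqP sy /eqP].
  by rewrite -sy => /perm_inj/eqP; rewrite eq_sym (negPf yz).
have CE x1 x2 : x1 != x2 -> C (x1, x2) = C (y, z).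
  move=> x12.
  have [u uy uz] := perm2_exists yz x12.
  rewrite /C -[RHS](card_imset _ (mulIg u)); apply: eq_card => s; rewrite !inE.
  apply/eqP/imsetP => [[sy sz]|[s' + ->]].
    exists (s * u^-1)%g; last by rewrite mulgKV.
    by rewrite inE !permM sy sz -uy -uz !permK.
  by rewrite inE => /eqP[sy sz]; rewrite !permM sy sz uy uz.
(* The constant counts the permutations fixing [y] and [z]; the identity is one of them. *)
exists (C (y, z))%:R => [|F].
  rewrite pnatr_eq0 -lt0n; apply/card_gt0P; exists 1%g.
  by rewrite inE !perm1.
rewrite (partition_big (fun s : 'S_n => (s y, s z)) predT) //=.
transitivity (\sum_(x : 'I_n * 'I_n) (C x)%:R * F x.1 x.2).
  apply: eq_bigr => x _; rewrite mulr_natl -sumr_const.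
  apply: eq_big => [s|s]; first by rewrite inE.
  by move=> /eqP <-.
rewrite -(pair_bigA _ (fun x1 x2 => (C (x1, x2))%:R * F x1 x2)) /=.
rewrite -sumrB mulr_sumr; apply: eq_bigr => x _.
rewrite (bigD1 x) //= C0 mul0r add0r [X in _ * (X - _)](bigD1 x) //= addrAC subrr add0r.
by rewrite mulr_sumr; apply: eq_bigr => x' x'x; rewrite CE // eq_sym.
Qed.

(** * Symmetrization and the coefficient that makes it trace-free *)

(** The action of $M$ on the factors [y] and [z]. The $D$ in the numerator of its last coefficient
    is absorbed by [contr]. *)
Definition recM_action (R : realType) (D l : nat) (y z : 'I_l.+1)
    (f : idx D l.+1 -> R) (I : idx D l.+1) : R :=
  (l%:R + 1)^-1 * (f I + l%:R * f (swap_idx y z I)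
    - (2 * l%:R / (D%:R + 2 * l%:R - 2)) * contr y z f I).

Definition sub_trace (R : realType) (D l : nat) (y z : 'I_l.+1)
    (f : idx D l.+1 -> R) (I : idx D l.+1) : R :=
  f I - l%:R / (D%:R + 2 * l%:R - 2) * contr y z f I.

Definition sym_sum (R : realType) (D n : nat) (g : idx D n -> R) (I : idx D n) : R :=
  \sum_(s : 'S_n) g (perm_idx s I).

Lemma sym_sum_perm (R : realType) (D n : nat) (g : idx D n -> R) (u : 'S_n)
    (I : idx D n) : sym_sum g (perm_idx u I) = sym_sum g I.
Proof.
rewrite /sym_sum [RHS](reindex_inj (mulIg u)) /=.
by apply: eq_bigr => s _; rewrite perm_idxM.
Qed.

(** The contribution of [s] depends only on which of [s y], [s z] belong to the pair of [y] and [z],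
    so [sum_perm2] reduces the sum to an explicit quadratic expression in the indicator [e]. *)
Lemma sym_sum_pair_trace (R : realType) (D l : nat) (y z : 'I_l.+1)
    (f : idx D l.+1 -> R) (I : idx D l.+1) :
  stf_away z f -> y != z -> D%:R + 2 * l%:R - 2 != 0 :> R ->
  \sum_(a < D) sym_sum (sub_trace y z f) (set2_idx y z a I) = 0.
Proof.
move=> af yz d0; rewrite exchange_big /= /sub_trace; set mu := _ / _.
have [K K0 KE] := sum_perm2 R yz.
pose e (k : 'I_l.+1) : R := ((k == y) || (k == z))%:R.
pose F x x' := (e x' - mu * (D%:R * (e x * e x') + e x + e x' - 2 * (e x * e x')))
  * pair_trace y z f I.
transitivity (\sum_(s : 'S_l.+1) F (s y) (s z)).
  apply: eq_bigr => s _; rewrite sumrB -mulr_sumr.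
  by rewrite pair_trace_sym // pair_trace_contr // /F /e; ring.
have e1 : \sum_k e k = 2.
  have zy : z != y by rewrite eq_sym.
  rewrite (bigD1 y) //= (bigD1 z) //= big1 ?addr0.
    by rewrite /e !eqxx orbT.
  by move=> k /andP[ky kz]; rewrite /e (negPf ky) (negPf kz).
have ee k : e k * e k = e k by rewrite /e -natrM mulnb andbb.
pose V := pair_trace y z f I.
have -> : \sum_(s : 'S_l.+1) F (s y) (s z) = K * 0; last by rewrite mulr0.
rewrite KE; congr (K * _).
transitivity ((\sum_x \sum_x' (- mu * (D%:R - 2) * (e x * e x') + (- mu) * e x
    + (1 - mu) * e x') - \sum_x (- mu * (D%:R - 2) + (- mu) + (1 - mu)) * e x) * V).
  rewrite mulrBl mulr_suml mulr_suml; congr (_ - _); apply: eq_bigr => x _.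
    by rewrite mulr_suml; apply: eq_bigr => x' _; rewrite /F -/V; ring.
  by rewrite /F -/V ee; ring.
have quad a b c : \sum_x \sum_x' (a * (e x * e x') + b * e x + c * e x') -
    \sum_x (a + b + c) * e x = 2 * a + 2 * l%:R * b + 2 * l%:R * c.
  have -> : \sum_x \sum_x' (a * (e x * e x') + b * e x + c * e x') =
      \sum_x ((2 * a + l.+1%:R * b) * e x + 2 * c).
    apply: eq_bigr => x _; rewrite !big_split /= -!mulr_sumr e1.
    by rewrite sumr_const card_ord -[_ *+ l.+1]mulr_natl; ring.
  rewrite big_split /= -!mulr_sumr e1 sumr_const card_ord -[_ *+ l.+1]mulr_natl.
  ring.
(* The sum is $2l-2\mu(D+2l-2)$, which vanishes for $\mu=l/(D+2l-2)$. *)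
by rewrite quad /mu; field.
Qed.

(** * Scalar products with tensors that are symmetric and trace-free off [z] *)

(** Setting both entries to the arbitrary value [a0] selects one representative in each class of
    multi-indices that agree off [p] and [q]. *)
Lemma sum_diag_pair (R : realType) (D n : nat) (a0 : 'I_D) (p q : 'I_n) (F : idx D n -> R) :
  \sum_(I : idx D n | I p == I q) F I =
  \sum_(I : idx D n | (I p == a0) && (I q == a0)) \sum_(a < D) F (set2_idx p q a I).
Proof.
rewrite exchange_big /= (partition_big (fun I : idx D n => I p) predT) //=.
apply: eq_bigr => a _.
rewrite (reindex_onto (fun I => set2_idx p q a I) (fun I => set2_idx p q a0 I)) /=.
  apply: eq_bigl => I; rewrite set2_idxl set2_idxr !eqxx set2_idxK /=.
  apply/eqP/andP => [<-|[/eqP Ip /eqP Iq]]; first by rewrite set2_idxl set2_idxr.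
  by rewrite set2_idx_id.
by move=> I /andP[/eqP Ipq /eqP Ip]; rewrite set2_idxK set2_idx_id // -Ipq.
Qed.

(** The delta at [s y] and [s z] contracts [t] over two factors different from [z], while the other
    factor of the product is constant along this contraction. *)
Lemma dot_contr_eq0 (R : realType) (D n : nat) (a0 : 'I_D) (y z : 'I_n) (s : 'S_n)
    (t f : idx D n -> R) :
  stf_away z t -> y != z -> s y != z -> s z != z ->
  \sum_I t I * contr y z f (perm_idx s I) = 0.
Proof.
move=> at_ yz syz szz; have syNz : s y != s z by rewrite (inj_eq perm_inj).
have -> : \sum_I t I * contr y z f (perm_idx s I) =
    \sum_(I : idx D n | I (s y) == I (s z)) t I * pair_trace y z f (perm_idx s I).
  rewrite [RHS]big_mkcond; apply: eq_bigr => I _; rewrite /contr !ffunE.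
  by case: eqP; rewrite ?mul1r ?mul0r ?mulr0.
rewrite (sum_diag_pair a0) big1 // => I _.
under eq_bigr => a _.
  have -> : pair_trace y z f (perm_idx s (set2_idx (s y) (s z) a I)) =
      pair_trace y z f (perm_idx s I).
    by rewrite perm_idx_set2 !permK pair_trace_set2.
  over.
by rewrite -mulr_suml (at_.2 _ _ _ syNz syz szz) mul0r.
Qed.

(** Permutations fixing [z] are moved onto [t], which absorbs them. If [s y = z], the swap symmetry
    of [contr] reduces to that case. *)
Lemma dot_contr (R : realType) (D n : nat) (a0 : 'I_D) (y z : 'I_n) (s : 'S_n)
    (t f : idx D n -> R) :
  stf_away z t -> stf_away z f -> y != z ->
  \sum_I t I * contr y z f (perm_idx s I) =
  ((s y == z) || (s z == z))%:R * \sum_I t I * contr y z f I.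
Proof.
move=> at_ af yz.
have fixz (u : 'S_n) : u z = z ->
    \sum_I t I * contr y z f (perm_idx u I) = \sum_I t I * contr y z f I.
  move=> uz; rewrite [RHS](reindex_inj (bij_inj (@perm_idx_bij D n u))) /=.
  by apply: eq_bigr => I _; rewrite at_.1.
case: (boolP (s z == z)) => [/eqP/fixz ->|szz]; first by rewrite orbT mul1r.
case: (boolP (s y == z)) => [/eqP syz|syz]; last first.
  by rewrite mul0r (dot_contr_eq0 a0).
rewrite mul1r -(fixz (tperm y z * s)%g); last by rewrite permM tpermR.
by apply: eq_bigr => I _; rewrite -perm_idxM contr_swap.
Qed.

(** The stabilizer of [z] has two double cosets in the symmetric group, represented by the identity
    and the swap of [y] and [z]; [t] absorbs it on one side and [f] on the other. *)
Lemma dot_sym (R : realType) (D n : nat) (y z : 'I_n) (s : 'S_n) (t f : idx D n -> R) :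
  stf_away z t -> stf_away z f -> y != z ->
  \sum_I t I * f (perm_idx s I) =
  if s z == z then \sum_I t I * f I else \sum_I t I * f (swap_idx y z I).
Proof.
move=> at_ af yz; case: eqP => [sz|/eqP szz].
  by apply: eq_bigr => I _; rewrite af.1.
(* This [b] fixes [z] and brings [s z] to [y], so that [s * b * tperm y z] fixes [z]. *)
pose b := tperm (s z) y.
have bz : b z = z by rewrite /b tpermD.
rewrite (reindex_inj (bij_inj (@perm_idx_bij D n b))) /=; apply: eq_bigr => I _.
rewrite at_.1 // perm_idxM -[f (swap_idx _ _ _)](af.1 (s * b * tperm y z)%g); last first.
  by rewrite !permM tpermL tpermL.
by rewrite -[swap_idx _ _ _]/(perm_idx _ _) perm_idxM -!mulgA tperm2 mulg1.
Qed.

(** This is where the coefficients of $M$ come from. A fraction $1/(l+1)$ of the permutations fixes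
    [z], and the others act as the swap, giving $1$ and $l$. A fraction $2/(l+1)$ sends [y] or [z]
    to [z], which doubles the trace coefficient of [sub_trace]. *)
Lemma dot_sym_sum (R : realType) (D l : nat) (a0 : 'I_D) (y z : 'I_l.+1) :
  y != z -> (0 < l)%N ->
  exists kappa : R, forall t f : idx D l.+1 -> R, stf_away z t -> stf_away z f ->
  \sum_I t I * (kappa * sym_sum (sub_trace y z f) I) =
  \sum_I t I * recM_action y z f I.
Proof.
move=> yz l0; have [K K0 KE] := sum_perm2 R yz.
(* With [K] permutations for each of the $l(l+1)$ ordered pairs of distinct values, this is
   $1/(l+1)!$, which turns the sum into an average. *)
exists (K * l%:R * (l%:R + 1))^-1 => t f at_ af; rewrite /recM_action.
under eq_bigr do rewrite /sym_sum /sub_trace.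
set mu := l%:R / _; set c := _ / (_ - 2).
pose a := \sum_I t I * f I; pose b := \sum_I t I * f (swap_idx y z I).
pose g := \sum_I t I * contr y z f I.
pose e (k : 'I_l.+1) : R := (k == z)%:R.
have e1 : \sum_k e k = 1.
  by rewrite (bigD1 z) //= big1 /e ?eqxx ?addr0 // => k /negPf ->.
have l1 : l%:R + 1 != 0 :> R by rewrite natr1 pnatr_eq0.
have ln : l%:R != 0 :> R by rewrite pnatr_eq0 -lt0n.
have ee k : e k * e k = e k by rewrite /e -natrM mulnb andbb.
transitivity ((l%:R + 1)^-1 * (a + l%:R * b - c * g)); last first.
  rewrite /a /b /g mulrBr mulrDr !mulr_sumr -big_split -sumrB /=.
  by apply: eq_bigr => I _; ring.
pose F x x' := e x' * a + (1 - e x') * b - mu * ((e x + e x' - e x * e x') * g).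
transitivity ((K * l%:R * (l%:R + 1))^-1 * \sum_(s : 'S_l.+1) F (s y) (s z)).
  transitivity ((K * l%:R * (l%:R + 1))^-1 * \sum_I \sum_(s : 'S_l.+1)
      t I * (f (perm_idx s I) - mu * contr y z f (perm_idx s I))).
    by rewrite mulr_sumr; apply: eq_bigr => I _; rewrite -mulr_sumr; ring.
  rewrite exchange_big; congr (_ * _); apply: eq_bigr => s _ /=.
  transitivity (\sum_I t I * f (perm_idx s I) -
      mu * \sum_I t I * contr y z f (perm_idx s I)).
    by rewrite mulr_sumr -sumrB; apply: eq_bigr => I _; ring.
  rewrite (dot_sym _ at_ af yz) (dot_contr a0 _ at_ af yz) /F /e -/a -/b -/g.
  by case: (s z == z); case: (s y == z); rewrite /=; ring.
(* The coefficient [x0] drops out because [e x * e x'] is supported on the diagonal, which is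
   subtracted. *)
have quad u v w x0 : \sum_x \sum_x' (u + v * e x + w * e x' + x0 * (e x * e x')) -
    \sum_x (u + (v + w + x0) * e x) = (l%:R + 1) * l%:R * u + l%:R * (v + w).
  have -> : \sum_x \sum_x' (u + v * e x + w * e x' + x0 * (e x * e x')) =
      \sum_x ((l.+1%:R * u + w) + (l.+1%:R * v + x0) * e x).
    apply: eq_bigr => x _; rewrite !big_split /= -!mulr_sumr e1.
    by rewrite !sumr_const card_ord; ring.
  rewrite !big_split /= -!mulr_sumr e1 !sumr_const card_ord.
  ring.
have -> : \sum_(s : 'S_l.+1) F (s y) (s z) =
    K * ((l%:R + 1) * l%:R * b + l%:R * ((- mu * g) + (a - b - mu * g))).
  rewrite KE -(quad _ _ _ (mu * g)); congr (K * (_ - _)); apply: eq_bigr => x _.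
    by apply: eq_bigr => x' _; rewrite /F; ring.
  by rewrite /F ee; ring.
rewrite /c /mu; move: (_ - 2)^-1 => di; field.
by rewrite K0 ln l1.
Qed.

(** * The projector as a product $AMA$ *)

Lemma mulmx_eq_col (R : realType) (N : nat) (A B : 'M[R]_N) :
  (forall u : 'cV_N, A *m u = B *m u) -> A = B.
Proof.
move=> AB; apply/eqP; rewrite -subr_eq0 -[_ - _]mulmx1; apply/eqP.
by apply: mulmx_eq0_col => u; rewrite mul1mx mulmxBl AB subrr.
Qed.

(** The orthogonal projector onto the symmetric trace-free tensors meets the characterization, so
    uniqueness identifies it with [stf_proj]. *)
Lemma stf_proj_tr (R : realType) (D n : nat) :
  (stf_proj R D n)^T = stf_proj R D n.
Proof. by have [P [PT /stf_projE <-]] := stf_proj_exists_tr R D n. Qed.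

Lemma stf_proj_stf (R : realType) (D n : nat) (u : tensor R D n) :
  symmetric_tensor (stf_proj R D n *m u) /\ trace_free (stf_proj R D n *m u).
Proof. by have [_ imP _] := stf_projP R D n; apply/imP; exists u. Qed.

Lemma stf_proj_fix (R : realType) (D n : nat) (t : tensor R D n) :
  symmetric_tensor t -> trace_free t -> stf_proj R D n *m t = t.
Proof.
move=> st tt; have [PP imP _] := stf_projP R D n.
by have /imP[u ->] := conj st tt; rewrite mulmxA PP.
Qed.

Lemma stf_away_stf (R : realType) (D n : nat) (z : 'I_n) (t : tensor R D n) :
  symmetric_tensor t -> trace_free t -> stf_away z (tcoef t).
Proof. by move=> st tt; split=> [s I _|p q I pq _ _]; [exact: st|exact: tt]. Qed.

(** Once symmetry is known, a permutation sending [y], [z] to [p], [q] reduces every trace to the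
    one over [y] and [z]. *)
Lemma sym_sum_stf (R : realType) (D l : nat) (y z : 'I_l.+1)
    (f : idx D l.+1 -> R) (t : tensor R D l.+1) (kappa : R) :
  stf_away z f -> y != z -> D%:R + 2 * l%:R - 2 != 0 :> R ->
  (forall I, tcoef t I = kappa * sym_sum (sub_trace y z f) I) ->
  symmetric_tensor t /\ trace_free t.
Proof.
move=> af yz d0 tE.
have st : symmetric_tensor t by move=> s I; rewrite !tE sym_sum_perm.
split=> // p q I pq; have [u uy uz] := perm2_exists yz pq.
transitivity (kappa * \sum_(a < D) sym_sum (sub_trace y z f)
    (set2_idx y z a (perm_idx u I))); last by rewrite sym_sum_pair_trace // mulr0.
rewrite mulr_sumr; apply: eq_bigr => a _; rewrite -tE -(st u) -[X in tcoef t X]/(perm_idx u _).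
by rewrite perm_idx_set2 -[in u^-1%g p]uy -[in u^-1%g q]uz !permK.
Qed.

Lemma stf_proj_sandwich (R : realType) (D l : nat) (y z : 'I_l.+1)
    (A N : op R D l.+1) :
  (2 <= D)%N -> (0 < l)%N -> y != z -> A^T = A -> N^T = N ->
  (forall t, stf_away z (tcoef (A *m t))) ->
  (forall t, stf_away z (tcoef t) -> A *m t = t) ->
  (forall t I, tcoef (N *m t) I = recM_action y z (tcoef t) I) ->
  stf_proj R D l.+1 = A *m N *m A.
Proof.
move=> D2 l0 yz AT NT imA fixA NE; set P := stf_proj _ _ _.
have d0 : D%:R + 2 * l%:R - 2 != 0 :> R.
  have -> : D%:R + 2 * l%:R - 2 = (D + 2 * l - 2)%:R :> R.
    by rewrite natrB ?(leq_trans D2) ?leq_addr // natrD natrM.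
  by rewrite pnatr_eq0; lia.
have l1 : l%:R + 1 != 0 :> R by rewrite natr1 pnatr_eq0.
pose X := A *m N *m A; have XT : X^T = X by rewrite !trmx_mul AT NT mulmxA.
have XP : X *m P = P.
  apply: mulmx_eq_col => u; rewrite -mulmxA; set t := P *m u.
  have [st tt] : symmetric_tensor t /\ trace_free t := stf_proj_stf u.
  have At := fixA t (stf_away_stf z st tt).
  (* On a symmetric trace-free tensor the swap is trivial and the trace vanishes, so [N] acts as
     $(1+l)/(l+1)=1$. *)
  rewrite /X -!mulmxA At (_ : N *m t = t) //; apply: tensorP => I.
  rewrite NE /recM_action /contr /pair_trace tt // st.
  by field; rewrite d0 l1.
have PX : P *m X = X.
  apply: mulmx_eq_col => u; rewrite -mulmxA.
  suff [st tt] : symmetric_tensor (X *m u) /\ trace_free (X *m u).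
    exact: stf_proj_fix.
  rewrite /X -!mulmxA; set w := A *m u.
  (* [Ordinal D2] is just some basis label, serving as the base point [a0]. *)
  have [kappa kE] := dot_sym_sum R (Ordinal D2) yz l0.
  pose T : tensor R D l.+1 := \col_i (kappa * sym_sum (sub_trace y z (tcoef w)) (enum_val i)).
  have TE I : tcoef T I = kappa * sym_sum (sub_trace y z (tcoef w)) I.
    by rewrite /tcoef mxE enum_rankK.
  have [sT tT] := sym_sum_stf (imA u) yz d0 TE.
  suff -> : A *m (N *m w) = T by [].
  rewrite -(fixA T (stf_away_stf z sT tT)); apply: tensorP => I.
  (* As [A] is symmetric, its row [I] is the image under [A] of a basis tensor, hence an admissible
     test tensor in [kE]. This gives [A *m (N *m w) = A *m T], and [A] fixes [T]. *)
  have ocA J : ocoef A I J = tcoef (A *m delta_mx (enum_rank I) 0) J.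
    by rewrite /tcoef -colE mxE /ocoef -[in RHS]AT mxE.
  rewrite !tcoef_mul; under eq_bigr do rewrite ocA NE.
  rewrite -kE; [|exact: imA..].
  by apply: eq_bigr => J _; rewrite ocA TE.
(* Transposing $XP=P$ gives $P=PX$, which equals $X$. *)
by rewrite -/X -[LHS]stf_proj_tr -/P -XP trmx_mul XT stf_proj_tr -/P PX.
Qed.

(** * Slices: fixing the entry at the factor [z] *)

Definition del_idx (D l : nat) (z : 'I_l.+1) (I : idx D l.+1) : idx D l :=
  [ffun a => I (lift z a)].

Definition ins_idx (D l : nat) (z : 'I_l.+1) (b : 'I_D) (J : idx D l) : idx D l.+1 :=
  [ffun k => if unlift z k is Some a then J a else b].

Definition slice (R : realType) (D l : nat) (z : 'I_l.+1) (b : 'I_D)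
    (t : tensor R D l.+1) : tensor R D l :=
  \col_i tcoef t (ins_idx z b (enum_val i)).

Lemma tcoef_slice (R : realType) (D l : nat) (z : 'I_l.+1) (b : 'I_D)
    (t : tensor R D l.+1) (J : idx D l) :
  tcoef (slice z b t) J = tcoef t (ins_idx z b J).
Proof. by rewrite {1}/tcoef mxE enum_rankK. Qed.

Lemma ins_idxK (D l : nat) (z : 'I_l.+1) (b : 'I_D) (J : idx D l) :
  del_idx z (ins_idx z b J) = J.
Proof. by apply/ffunP => a; rewrite !ffunE liftK. Qed.

Lemma del_idxK (D l : nat) (z : 'I_l.+1) (I : idx D l.+1) :
  ins_idx z (I z) (del_idx z I) = I.
Proof.
by apply/ffunP => k; rewrite ffunE; case: unliftP => [a ->|->] //; rewrite ffunE.
Qed.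

Lemma ins_idx_hole (D l : nat) (z : 'I_l.+1) (b : 'I_D) (J : idx D l) :
  ins_idx z b J z = b.
Proof. by rewrite ffunE unlift_none. Qed.

(** The window omits exactly the factor [z], so the operator is diagonal in the entry at [z] and
    acts as [P] on each slice. *)
Lemma slice_legs (R : realType) (D h l : nat) (hn : (h + l <= l.+1)%N)
    (z : 'I_l.+1) (P : op R D l) (t : tensor R D l.+1) (b : 'I_D) :
  (forall a, window hn a = lift z a) ->
  slice z b (legs hn P *m t) = P *m slice z b t.
Proof.
move=> hz.
have winE (I : idx D l.+1) : [ffun a => I (window hn a)] = del_idx z I.
  by apply/ffunP => a; rewrite !ffunE hz.
have outE (I J : idx D l.+1) :
    [forall k : 'I_l.+1, (h <= k < h + l)%N || (I k == J k)] = (I z == J z).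
  apply/forallP/idP => [/(_ z)|IJ k].
    case/orP => // /andP[hz1 hz2]; have lt_zl : (z - h < l)%N by lia.
    have /eqP := neq_lift z (Ordinal lt_zl); rewrite -hz; case.
    by apply/val_inj => /=; lia.
  case: (unliftP z k) => [a ->|->]; last by rewrite IJ orbT.
  by rewrite -hz /= ltn_add2l leq_addr ltn_ord.
apply: tensorP => J; rewrite tcoef_slice !tcoef_mul.
rewrite (bigID (fun K : idx D l.+1 => K z == b)) /= [X in _ + X]big1 ?addr0; last first.
  by move=> K /negPf Kb; rewrite ocoef_op_of outE ins_idx_hole eq_sym Kb mulr0 mul0r.
rewrite (reindex_onto (ins_idx z b) (del_idx z)) /=; last first.
  by move=> K /eqP <-; rewrite del_idxK.
apply: eq_big => [K|K _]; first by rewrite ins_idx_hole ins_idxK !eqxx.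
by rewrite ocoef_op_of outE !winE !ins_idxK !ins_idx_hole eqxx mulr1 tcoef_slice.
Qed.

Lemma slice_inj (R : realType) (D l : nat) (z : 'I_l.+1) (t u : tensor R D l.+1) :
  (forall b, slice z b t = slice z b u) -> t = u.
Proof.
by move=> tu; apply: tensorP => I; rewrite -(del_idxK z I) -!tcoef_slice tu.
Qed.

Lemma ins_idx_perm (D l : nat) (z : 'I_l.+1) (s : 'S_l) (b : 'I_D) (J : idx D l) :
  ins_idx z b (perm_idx s J) = perm_idx (lift_perm z z s) (ins_idx z b J).
Proof.
apply/ffunP => k; rewrite !ffunE; case: (unliftP z k) => [a ->|->].
  by rewrite lift_perm_lift liftK ffunE.
by rewrite lift_perm_id unlift_none.
Qed.

Lemma ins_idx_set2 (D l : nat) (z : 'I_l.+1) (p q : 'I_l) (a b : 'I_D) (J : idx D l) :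
  ins_idx z b (set2_idx p q a J) = set2_idx (lift z p) (lift z q) a (ins_idx z b J).
Proof.
apply/ffunP => k; rewrite !ffunE; case: (unliftP z k) => [c ->|->].
  by rewrite ffunE !(inj_eq lift_inj).
by rewrite !(negPf (neq_lift _ _)).
Qed.

Lemma lift_permP (n : nat) (z : 'I_n.+1) (s : 'S_n.+1) :
  s z = z -> exists s', s = lift_perm z z s'.
Proof.
move=> sz.
have ne a : z != s (lift z a).
  by rewrite -[X in X != _]sz (inj_eq perm_inj) neq_lift.
(* The default is never taken, since [s (lift z a)] differs from [z]. *)
pose g a := odflt a (unlift z (s (lift z a))).
have gE a : lift z (g a) = s (lift z a).
  by rewrite /g; case: unliftP (ne a) => [c ->|->] //=; rewrite eqxx.
have g_inj : injective g.
  by move=> a c /(congr1 (lift z)); rewrite !gE => /perm_inj/lift_inj.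
exists (perm g_inj); apply/permP => k; case: (unliftP z k) => [a ->|->].
  by rewrite lift_perm_lift permE gE.
by rewrite lift_perm_id sz.
Qed.

(** The permutations fixing [z] are the lifts of permutations of the other factors, and the pairs
    avoiding [z] are the lifts of their pairs. *)
Lemma stf_awayP (R : realType) (D l : nat) (z : 'I_l.+1) (t : tensor R D l.+1) :
  stf_away z (tcoef t) <->
  forall b, symmetric_tensor (slice z b t) /\ trace_free (slice z b t).
Proof.
split=> [[st tt] b|sl].
  split=> [s J|p q J pq].
    by rewrite !tcoef_slice -[finfun _]/(perm_idx s J) ins_idx_perm st ?lift_perm_id.
  under eq_bigr do rewrite tcoef_slice ins_idx_set2.
  by apply: tt; rewrite ?(inj_eq lift_inj) // eq_sym neq_lift.
split=> [s I /lift_permP[s' ->]|p q I pq pz qz].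
  rewrite -(del_idxK z I) -ins_idx_perm -!tcoef_slice.
  by have [-> //] := sl (I z).
case: (unliftP z p) pq pz => [p' ->|->]; last by rewrite eqxx.
case: (unliftP z q) qz => [q' ->|->]; last by rewrite eqxx.
move=> _ pq _; rewrite -(del_idxK z I).
under eq_bigr do rewrite -ins_idx_set2 -tcoef_slice.
by have [_ ->] := sl (I z) => //; rewrite (inj_eq lift_inj) in pq.
Qed.

(** * The operators on the larger tensor power and the two recursive relations *)

Lemma legsM (R : realType) (D h l : nat) (hn : (h + l <= l.+1)%N)
    (z : 'I_l.+1) (P Q : op R D l) :
  (forall a, window hn a = lift z a) ->
  legs hn (P *m Q) = legs hn P *m legs hn Q.
Proof.
move=> hz; apply: mulmx_eq_col => u; apply: (@slice_inj _ _ _ z) => b.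
by rewrite -mulmxA !(slice_legs _ _ _ hz) mulmxA.
Qed.

Lemma legsD (R : realType) (D h n N : nat) (hn : (h + n <= N)%N)
    (A B : op R D n) : legs hn (A + B) = legs hn A + legs hn B.
Proof. by apply/matrixP => i j; rewrite !mxE /ocoef !mxE mulrDl. Qed.

Lemma permutator_tr (R : realType) (D : nat) : (permutator R D)^T = permutator R D.
Proof.
apply/matrixP => i j; rewrite !mxE; congr (nat_of_bool _)%:R.
by rewrite andbC; congr (_ && _); exact: eq_sym.
Qed.

Lemma recM_tr (R : realType) (D l : nat) : (recM R D l)^T = recM R D l.
Proof.
rewrite /recM linearZ; congr (_ *: _).
by rewrite linearB linearD !linearZ /= permutator_tr trace_proj_tr trmx1.
Qed.

Lemma swap_idxC (D n : nat) (y z : 'I_n) (I : idx D n) :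
  swap_idx y z I = swap_idx z y I.
Proof. by rewrite /swap_idx tpermC. Qed.

Lemma tcoef_legs_recM (R : realType) (D l h : nat) (hh : (h + 2 <= l.+1)%N)
    (t : tensor R D l.+1) (I : idx D l.+1) : (0 < D)%N ->
  tcoef (legs hh (recM R D l) *m t) I =
  recM_action (window hh 0) (window hh 1) (tcoef t) I.
Proof.
move=> D0.
have ->: tcoef (legs hh (recM R D l) *m t) I = (l%:R + 1)^-1 * (tcoef t I +
    l%:R * tcoef (legs hh (permutator R D) *m t) I -
    (2 * D%:R * l%:R / (D%:R + 2 * l%:R - 2)) * tcoef (legs hh (trace_proj R D) *m t) I).
  rewrite /recM legsZ legsB legsD !legsZ legs1 -scalemxAl mulmxBl mulmxDl mul1mx -!scalemxAl.
  by rewrite /tcoef !mxE.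
rewrite tcoef_legs_perm tcoef_legs_trace /recM_action /contr /pair_trace.
have D0' : D%:R != 0 :> R by rewrite pnatr_eq0 -lt0n.
have l1 : l%:R + 1 != 0 :> R by rewrite natr1 pnatr_eq0.
by move: (_ - 2)^-1 => d; field; rewrite D0' l1.
Qed.

Lemma recM_action_C (R : realType) (D l : nat) (y z : 'I_l.+1)
    (f : idx D l.+1 -> R) (I : idx D l.+1) :
  recM_action y z f I = recM_action z y f I.
Proof.
rewrite /recM_action /contr /pair_trace swap_idxC eq_sym.
by under eq_bigr do rewrite set2_idxC.
Qed.

(** Common form of both recursions: [z] is the factor left out by $\mathcal P^l$ and [y] its
    neighbour. The disjunction allows [z] to come last or first in the pair on which $M$ acts. *)
Lemma stf_proj_rec (R : realType) (D l h h' : nat) (hn : (h + l <= l.+1)%N)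
    (hh : (h' + 2 <= l.+1)%N) (y z : 'I_l.+1) :
  (2 <= D)%N -> (0 < l)%N -> y != z -> (forall a, window hn a = lift z a) ->
  (window hh 0 = y /\ window hh 1 = z) \/ (window hh 0 = z /\ window hh 1 = y) ->
  stf_proj R D l.+1 =
    legs hn (stf_proj R D l) *m legs hh (recM R D l) *m legs hn (stf_proj R D l).
Proof.
move=> D2 l0 yz hz wyz; apply: (stf_proj_sandwich D2 l0 yz).
- by rewrite legs_tr stf_proj_tr.
- by rewrite legs_tr recM_tr.
- by move=> t; apply/stf_awayP => b; rewrite slice_legs //; exact: stf_proj_stf.
- move=> t /stf_awayP at_; apply: (@slice_inj _ _ _ z) => b; rewrite slice_legs //.
  by have [st tt] := at_ b; exact: stf_proj_fix.
- move=> t I; rewrite tcoef_legs_recM //; last exact: ltnW.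
  by case: wyz => -[-> ->] //; rewrite recM_action_C.
Qed.

Lemma window_first (l : nat) (a : 'I_l) : window (first_factors l) a = lift ord_max a.
Proof. by apply/val_inj; rewrite /= /bump leqNgt ltn_ord. Qed.

Lemma window_last (l : nat) (a : 'I_l) : window (last_factors l) a = lift ord0 a.
Proof. by apply/val_inj. Qed.

Lemma stf_proj_rec_first (R : realType) (D l : nat) (hl : (1 <= l)%N) : (2 <= D)%N ->
  stf_proj R D l.+1 =
        legs (first_factors l) (stf_proj R D l)
        *m legs (last_pair hl) (recM R D l)
        *m legs (first_factors l) (stf_proj R D l).
Proof.
move=> D2; apply: (@stf_proj_rec _ _ _ _ _ _ _
  (window (last_pair hl) 0) ord_max D2 hl _ (@window_first l)).
  by rewrite -val_eqE /=; lia.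
by left; split=> //; apply/val_inj => /=; lia.
Qed.

Lemma stf_proj_rec_last (R : realType) (D l : nat) (hl : (1 <= l)%N) : (2 <= D)%N ->
  stf_proj R D l.+1 =
        legs (last_factors l) (stf_proj R D l)
        *m legs (first_pair hl) (recM R D l)
        *m legs (last_factors l) (stf_proj R D l).
Proof.
move=> D2; apply: (@stf_proj_rec _ _ _ _ _ _ _
  (window (first_pair hl) 1) ord0 D2 hl _ (@window_last l)).
  by rewrite -val_eqE.
by right; split=> //; apply/val_inj.
Qed.

(** * Polynomial expression of the projectors *)

Lemma legs_legs (R : realType) (D h l : nat) (hh : (h + 2 <= l)%N)
    (hh' : (h + 2 <= l.+1)%N) (X : op R D 2) :
  legs (first_factors l) (legs hh X) = legs hh' X.
Proof.
apply/matrixP => i j; rewrite !mxE !ocoef_op_of -mulrA -natrM mulnb.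
set I := enum_val i; set J := enum_val j.
congr (ocoef X _ _ * (nat_of_bool _)%:R).
- by apply/ffunP => a; rewrite !ffunE; congr (I _); apply/val_inj.
- by apply/ffunP => a; rewrite !ffunE; congr (J _); apply/val_inj.
apply/andP/forallP => [[/forallP inn /forallP out] k|IJ].
  case: (ltnP k l) => kl; last first.
    by have := out k; rewrite /= add0n ltnNge kl /= => ->; rewrite orbT.
  have := inn (Ordinal kl); rewrite !ffunE /=.
  by rewrite (_ : window _ _ = k) //; apply/val_inj.
split; apply/forallP => k.
  have := IJ (window (first_factors l) k); rewrite !ffunE /=.
  by [].
have := IJ k; rewrite add0n; case: (ltnP k l) => //= kl /orP[/andP[_]|->//].
by move=> kh; have := leq_trans kh hh; rewrite ltnNge kl.
Qed.

(** Extension by the identity on the last factor is a unital algebra morphism that maps generators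
    to generators. *)
Lemma legs_first_poly (R : realType) (D l : nat) (A : op R D l) :
  is_polynomial_in (@perm_or_trace R D l) A ->
  is_polynomial_in (@perm_or_trace R D l.+1) (legs (first_factors l) A).
Proof.
elim=> {A} [A [h [hh AE]]|c|A B _ IHA _ IHB|A B _ IHA _ IHB].
- have hh' : (h + 2 <= l.+1)%N by exact: leqW.
  by apply: poly_gen; exists h, hh'; case: AE => ->; rewrite (legs_legs hh hh'); [left|right].
- by rewrite -scalemx1 legsZ legs1 scalemx1; exact: poly_scalar.
- by rewrite legsD; exact: poly_add.
- by rewrite (legsM _ _ (@window_first l)); exact: poly_mul.
Qed.

Lemma poly_scale (R : realType) (N : nat) (gen : 'M[R]_N -> Prop) (c : R)
    (A : 'M[R]_N) : is_polynomial_in gen A -> is_polynomial_in gen (c *: A).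
Proof.
by move=> pA; rewrite -mul_scalar_mx; apply: poly_mul => //; exact: poly_scalar.
Qed.

Lemma legs_recM_poly (R : realType) (D l h : nat) (hh : (h + 2 <= l.+1)%N) :
  is_polynomial_in (@perm_or_trace R D l.+1) (legs hh (recM R D l)).
Proof.
rewrite /recM legsZ legsB legsD !legsZ legs1 -scaleNr.
apply: poly_scale; apply: poly_add; first apply: poly_add; first exact: poly_scalar.
  by apply: poly_scale; apply: poly_gen; exists h, hh; left.
by apply: poly_scale; apply: poly_gen; exists h, hh; right.
Qed.

Lemma stf_proj_poly (R : realType) (D l : nat) : (2 <= D)%N -> (1 <= l)%N ->
  is_polynomial_in (@perm_or_trace R D l) (stf_proj R D l).
Proof.
move=> D2; elim: l => // -[_ _|l IHl _]; first by rewrite stf_proj1; exact: poly_scalar.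
rewrite (@stf_proj_rec_first _ _ _ (ltn0Sn l)) //.
have pA := legs_first_poly (IHl isT).
exact: poly_mul (poly_mul pA (legs_recM_poly _ _ _)) pA.
Qed.

Theorem proposition3p2 (R : realType) (D l : nat)
    (hD : (2 <= D)%N) (hl : (1 <= l)%N) :
  [/\ is_polynomial_in (@perm_or_trace R D l.+1) (stf_proj R D l.+1),
      stf_proj R D l.+1 =
        legs (first_factors l) (stf_proj R D l)
        *m legs (last_pair hl) (recM R D l)
        *m legs (first_factors l) (stf_proj R D l),
      stf_proj R D l.+1 =
        legs (last_factors l) (stf_proj R D l)
        *m legs (first_pair hl) (recM R D l)
        *m legs (last_factors l) (stf_proj R D l)
    & (stf_proj R D l)^T = stf_proj R D l].
Proof.
split; first exact: stf_proj_poly.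
- exact: stf_proj_rec_first.
- exact: stf_proj_rec_last.
exact: stf_proj_tr.
Qed.
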